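(* Let $N \cong \mathbb{Z}^2$ be a lattice and let $\Delta_1 \subseteq \Delta_2 \subseteq N_{\mathbb{R}}$ be two-dimensional reflexive polytopes. For $i=1,2$ let $\widehat{\Sigma}(\Delta_i)$ be the unique MPCP subdivision of the fan $\Sigma(\Delta_i)$. Then $\widehat{\Sigma}(\Delta_2)$ is a refinement of $\widehat{\Sigma}(\Delta_1)$.
   Context: Let $N\cong\mathbb{Z}^n$ be a lattice, $M = \mathrm{Hom}(N,\mathbb{Z})$, $N_{\mathbb{R}} = N\otimes\mathbb{R}$, $M_{\mathbb{R}} = M\otimes\mathbb{R}$, with pairing $\langle\cdot,\cdot\rangle : M_{\mathbb{R}}\times N_{\mathbb{R}}\to\mathbb{R}$. A lattice polytope $\Delta\subseteq N_{\mathbb{R}}$ with the origin in its interior is called reflexive if the dual polytope $\Delta^* = \{ m\in M_{\mathbb{R}} \mid \langle m,n\rangle\ge -1 \ \forall n\in\Delta\}$ is also a lattice polytope (with respect to $M$). The cone over a subset $S$ of a real vector space is $\mathbb{R}_{\ge 0}S = \{rs \mid r\in\mathbb{R}, r\ge 0, s\in S\}$. The fan $\Sigma(\Delta)$ consists of the cones over the proper faces of $\Delta$. An MPCP (maximal projective crepant partial) subdivision $\widehat{\Sigma}(\Delta)$ of $\Sigma(\Delta)$ is a fan subdividing $\Sigma(\Delta)$ which is projective (its toric variety is projective), whose maximal cones are cones over elementary simplices (lattice simplices containing no lattice points except their vertices), and such that the primitive integral generators of all its rays are lattice points in the boundary of $\Delta$. When $\Delta$ is two-dimensional there is exactly one MPCP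 subdivision of $\Sigma(\Delta)$: the fan whose maximal cones are the cones over line segments $\mathrm{Conv}(v_1,v_2)$, where $v_1,v_2$ are adjacent lattice points in an edge of $\Delta$. A complete fan $F_2$ is a refinement (subdivision) of a complete fan $F_1$ if every cone of $F_2$ is contained in a cone of $F_1$. *)

(* Defs.v *)
From HB Require Import structures.
From mathcomp Require Import all_boot all_order all_algebra.
From mathcomp Require Import all_classical all_reals all_analysis.

Set Implicit Arguments.
Unset Strict Implicit.
Unset Printing Implicit Defensive.

Import Order.TTheory GRing.Theory Num.Theory.
Import numFieldNormedType.Exports.

Local Open Scope classical_set_scope.
Local Open Scope ring_scope.

(* A lattice N of rank n is identified with Z^n by the choice of a basis:
   N_R is 'rV[R]_n, M_R is 'cV[R]_n, and N and M are the vectors with integer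
   entries. *)
Definition pairing (R : realType) (n : nat) (m : 'cV[R]_n) (x : 'rV[R]_n) : R :=
  (x *m m) 0 0.

Definition lattice_point (R : realType) (p q : nat) (x : 'M[R]_(p, q)) : Prop :=
  x \is a mxOver Num.int.

Definition conv_hull (R : realType) (V : lmodType R) (k : nat) (v : 'I_k -> V) :
    set V :=
  [set x | exists a : 'I_k -> R,
     [/\ forall i, 0 <= a i, \sum_i a i = 1 & x = \sum_i a i *: v i]].

Definition affinely_independent (R : realType) (V : lmodType R) (k : nat)
    (v : 'I_k -> V) : Prop :=
  forall a : 'I_k -> R,
    \sum_i a i = 0 -> \sum_i a i *: v i = 0 -> forall i, a i = 0.

Definition lattice_polytope (R : realType) (p q : nat) (P : set 'M[R]_(p, q)) :
    Prop :=
  exists k (v : 'I_k -> 'M[R]_(p, q)),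
    (forall i, lattice_point (v i)) /\ P = conv_hull v.

Definition dual_polytope (R : realType) (n : nat) (P : set 'rV[R]_n) :
    set 'cV[R]_n :=
  [set m | forall x, P x -> -1 <= pairing m x].

(* The origin being interior forces P to be n-dimensional. *)
Definition reflexive_polytope (R : realType) (n : nat) (P : set 'rV[R]_n) :
    Prop :=
  [/\ lattice_polytope P, P° 0 & lattice_polytope (dual_polytope P)].

(* The empty set is a proper face of a nonempty polytope (m = 0, c = -1). *)
Definition proper_face (R : realType) (n : nat) (P G : set 'rV[R]_n) : Prop :=
  (exists (m : 'cV[R]_n) (c : R),
     (forall x, P x -> c <= pairing m x) /\
     G = [set x | P x /\ pairing m x = c])
  /\ G <> P.

Definition cone_over (R : realType) (n : nat) (S : set 'rV[R]_n) :
    set 'rV[R]_n :=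
  [set x | exists r s, [/\ 0 <= r, S s & x = r *: s]].

(* Adding the origin only matters for the empty face, whose cone is {0}. *)
Definition face_fan (R : realType) (n : nat) (P : set 'rV[R]_n) :
    set (set 'rV[R]_n) :=
  [set s | exists2 G, proper_face P G & s = 0 |` cone_over G].

Definition rational_polyhedral_cone (R : realType) (n : nat)
    (s : set 'rV[R]_n) : Prop :=
  exists k (v : 'I_k -> 'rV[R]_n),
    (forall i, lattice_point (v i)) /\
    s = [set x | exists2 a : 'I_k -> R,
           forall i, 0 <= a i & x = \sum_i a i *: v i].

Definition strongly_convex (R : realType) (n : nat) (s : set 'rV[R]_n) : Prop :=
  forall x, s x -> s (- x) -> x = 0.

Definition cone_face (R : realType) (n : nat) (s t : set 'rV[R]_n) : Prop :=
  exists m : 'cV[R]_n,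
    (forall x, s x -> 0 <= pairing m x) /\
    t = [set x | s x /\ pairing m x = 0].

Definition is_fan (R : realType) (n : nat) (F : set (set 'rV[R]_n)) : Prop :=
  [/\ finite_set F,
      forall s, F s -> rational_polyhedral_cone s /\ strongly_convex s,
      forall s t, F s -> cone_face s t -> F t
    & forall s t, F s -> F t ->
        cone_face s (s `&` t) /\ cone_face t (s `&` t)].

Definition complete_fan (R : realType) (n : nat) (F : set (set 'rV[R]_n)) :
    Prop :=
  is_fan F /\ forall x, exists2 s, F s & s x.

Definition refines (R : realType) (n : nat) (F2 F1 : set (set 'rV[R]_n)) :
    Prop :=
  forall s2, F2 s2 -> exists2 s1, F1 s1 & s2 `<=` s1.

Definition maximal_cone (R : realType) (n : nat) (F : set (set 'rV[R]_n))
    (s : set 'rV[R]_n) : Prop :=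
  F s /\ forall t, F t -> s `<=` t -> t = s.

(* The toric variety of a complete fan is projective iff the fan carries a
   strictly convex support function (piecewise linear, integral on the
   lattice). *)
Definition projective_fan (R : realType) (n : nat) (F : set (set 'rV[R]_n)) :
    Prop :=
  exists phi : 'rV[R]_n -> R, forall s, maximal_cone F s ->
    exists m : 'cV[R]_n,
      [/\ lattice_point m,
          forall x, s x -> phi x = pairing m x
        & forall x, ~ s x -> pairing m x < phi x].

Definition elementary_simplex (R : realType) (n : nat) (S : set 'rV[R]_n) :
    Prop :=
  exists k (v : 'I_k.+1 -> 'rV[R]_n),
    [/\ forall i, lattice_point (v i),
        affinely_independent v,
        S = conv_hull v
      & forall x, S x -> lattice_point x -> exists i, x = v i].

Definition primitive_vector (R : realType) (n : nat) (u : 'rV[R]_n) : Prop :=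
  [/\ lattice_point u, u <> 0
    & forall (k : nat) (w : 'rV[R]_n),
        lattice_point w -> u = k%:R *: w -> k = 1%N].

(* The elementary simplices are lattice simplices of a triangulation of the
   boundary of P, so each of them lies in a proper face of P; without this
   requirement too many cones qualify: in Z^2, the cone spanned by (1,0) and
   (-1,2) contains (0,1), yet it is the cone over the segment from (1,0) to
   (-2,4), which has no other lattice points. *)
Definition MPCP_subdivision (R : realType) (n : nat) (P : set 'rV[R]_n)
    (F : set (set 'rV[R]_n)) : Prop :=
  [/\ complete_fan F /\ refines F (face_fan P),
      projective_fan F,
      forall s, maximal_cone F s ->
        exists S G, [/\ elementary_simplex S, proper_face P G, S `<=` G
                      & s = cone_over S]
    & forall u, primitive_vector u -> F (cone_over [set u]) ->
        (P `\` P°) u].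

(* Main.v *)
(* Let [v0], [v1] span a two-dimensional maximal cone of the fan of [D2]. By
   reflexivity the segment [v0 v1] lies on a line [<m, x> = -1] with [m] in [M];
   as it contains no further lattice points, [v0] and [v1] form a basis of [N],
   in which [<m, x> >= -1] on [D2] says that lattice points of [D2] have
   coordinates [(a, b)] with [a + b <= 1]; in particular [a <= 0] or [b <= 0].
   This applies to the generators [w i] of the cone of the fan of [D1] that
   contains [v0 + v1]. A nonnegative combination of vectors outside the open
   quadrant spanned by [v0] and [v1] can only hit [v0 + v1] if the [w i] lie on
   both sides of the quadrant, so their cone contains it. *)
Require Import Defs.
From HB Require Import structures.
From mathcomp Require Import all_boot all_order all_algebra.
From mathcomp Require Import all_classical all_reals all_analysis.
From mathcomp Require Import zify ring lra.

Import Order.TTheory GRing.Theory Num.Theory.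
Import numFieldNormedType.Exports.

Local Open Scope classical_set_scope.
Local Open Scope ring_scope.

Set Implicit Arguments.
Unset Strict Implicit.

(** * Linearity and integrality of the pairing; points of convex hulls *)

Lemma pairingD (R : realType) (n : nat) (m : 'cV[R]_n) (x y : 'rV[R]_n) :
  pairing m (x + y) = pairing m x + pairing m y.
Proof. by rewrite /pairing mulmxDl mxE. Qed.

Lemma pairingZ (R : realType) (n : nat) (m : 'cV[R]_n) (a : R) (x : 'rV[R]_n) :
  pairing m (a *: x) = a * pairing m x.
Proof. by rewrite /pairing -scalemxAl mxE. Qed.

Lemma pairing_sumr (R : realType) (n k : nat) (m : 'cV[R]_n)
    (a : 'I_k -> R) (v : 'I_k -> 'rV[R]_n) :
  pairing m (\sum_i a i *: v i) = \sum_i a i * pairing m (v i).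
Proof.
rewrite /pairing mulmx_suml summxE; apply: eq_bigr => i _.
by rewrite -scalemxAl mxE.
Qed.

Lemma pairing_suml (R : realType) (n k : nat) (a : 'I_k -> R)
    (m : 'I_k -> 'cV[R]_n) (x : 'rV[R]_n) :
  pairing (\sum_i a i *: m i) x = \sum_i a i * pairing (m i) x.
Proof.
rewrite /pairing mulmx_sumr summxE; apply: eq_bigr => i _.
by rewrite -scalemxAr mxE.
Qed.

Lemma pairing_int (R : realType) (n : nat) (m : 'cV[R]_n) (x : 'rV[R]_n) :
  lattice_point m -> lattice_point x -> pairing m x \is a Num.int.
Proof. by move=> hm hx; apply/mxOverP; apply: mxOverM. Qed.

Lemma conv_hull_vertex (R : realType) (V : lmodType R) (k : nat)
    (v : 'I_k -> V) (i : 'I_k) : conv_hull v (v i).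
Proof.
exists (fun j => (j == i)%:R); split=> [j||]; first exact: ler0n.
  by rewrite (bigD1 i) //= eqxx big1 ?addr0 // => j /negbTE ->.
rewrite (bigD1 i) //= eqxx scale1r big1 ?addr0 // => j /negbTE ->.
by rewrite scale0r.
Qed.

(** * Maximal cones of a fan and convexity of cones *)

Lemma finite_maximal_above (T : Type) (F : set (set T)) (s : set T) :
  finite_set F -> F s ->
  exists t, [/\ F t, s `<=` t & forall u, F u -> t `<=` u -> u = t].
Proof.
move=> /finite_seqP [l ->].
(* The starting set need not occur in [l]; this lets the induction restart from the new head [a]
   whenever the set found so far is contained in it. *)
suff H : forall s0 : set T, exists t, [/\ t = s0 \/ t \in l, s0 `<=` t
    & forall u, u \in l -> t `<=` u -> u = t].
  move=> /= sl; have [t [tl st tmax]] := H s; exists t; split=> //.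
  by case: tl => [->|].
elim: l => [s0|a l IH s0]; first by exists s0; split=> //; left.
have [t [tl st tmax]] := IH s0.
have [ta|nta] := pselect (t `<=` a); last first.
  exists t; split=> //.
    by case: tl => [|tl]; [left | right; rewrite in_cons tl orbT].
  by move=> u; rewrite in_cons => /orP[/eqP -> /nta|/tmax].
have [t' [t'l at' t'max]] := IH a.
exists t'; split.
- right; rewrite in_cons; case: t'l => [->|->]; first by rewrite eqxx.
  by rewrite orbT.
- by move=> x /st /ta /at'.
- move=> u; rewrite in_cons => /orP[/eqP ->|/t'max] // t'a.
  by apply/seteqP.
Qed.

Lemma fan_cone_subset_maximal (R : realType) (n : nat)
    (F : set (set 'rV[R]_n)) (s : set 'rV[R]_n) :
  is_fan F -> F s -> exists2 t, maximal_cone F t & s `<=` t.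
Proof.
move=> [finF _ _ _] Fs.
by have [t [Ft st tmax]] := finite_maximal_above finF Fs; exists t.
Qed.

Lemma polyhedral_cone_comb (R : realType) (n : nat) (s : set 'rV[R]_n)
    (k : nat) (c : 'I_k -> R) (w : 'I_k -> 'rV[R]_n) :
  rational_polyhedral_cone s -> (forall i, 0 <= c i) -> (forall i, s (w i)) ->
  s (\sum_i c i *: w i).
Proof.
move=> [p [v [_ ->]]] c0 sw.
apply: (@big_ind _ [set x | exists2 a : 'I_p -> R,
           forall i, 0 <= a i & x = \sum_i a i *: v i]) => /=.
- by exists (fun=> 0) => //; rewrite big1 // => i _; rewrite scale0r.
- move=> _ _ [a a0 ->] [b b0 ->]; exists (fun i => a i + b i).
    by move=> i; rewrite addr_ge0.
  by rewrite -big_split; apply: eq_bigr => i _; rewrite scalerDl.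
- move=> i _; have [a a0 ->] := sw i; exists (fun j => c i * a j).
    by move=> j; rewrite mulr_ge0.
  by rewrite scaler_sumr; apply: eq_bigr => j _; rewrite scalerA.
Qed.

(** * Polytopes around the origin and their duals *)

Lemma interior0_absorbing (R : realType) (n : nat) (P : set 'rV[R]_n)
    (x : 'rV[R]_n) :
  P° 0 -> exists2 e : R, 0 < e & P (e *: x).
Proof.
move=> P0.
have cvx : (fun e : R => e *: x) @ 0^'+ --> (0 : 'rV[R]_n).
  rewrite -(scale0r x); apply: cvg_at_right_filter.
  by apply: cvgZr_tmp; exact: cvg_id.
have near_P : \forall e \near 0^'+, P (e *: x) by exact: cvx.
near (0 : R)^'+ => e.
exists e; first by near: e; exact: nbhs_right_gt.
by near: e.
Unshelve. all: by end_near.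
Qed.

(** Evaluating at the origin gives [c <= 0]. If [c = 0], the functional is nonnegative near the
    origin, hence everywhere by scaling, hence zero by symmetry, and the face is all of [P]. *)
Lemma proper_face_level_lt0 (R : realType) (n : nat) (P : set 'rV[R]_n)
    (m : 'cV[R]_n) (c : R) :
  P° 0 -> (forall x, P x -> c <= pairing m x) ->
  [set x | P x /\ pairing m x = c] <> P -> c < 0.
Proof.
move=> P0 cP; rewrite lt_neqAle => nP; apply/andP; split; last first.
  have := cP 0 (interior_subset P0).
  by rewrite -(scale0r 0) pairingZ mul0r.
apply/eqP => c0; apply: nP; rewrite c0 in cP *.
have m_ge0 x : 0 <= pairing m x.
  have [e e0 /cP] := interior0_absorbing x P0.
  by rewrite pairingZ pmulr_rge0.
apply/seteqP; split=> [x []//|x Px]; split=> //.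
apply/eqP; rewrite eq_le m_ge0 andbT.
by have := m_ge0 (-1 *: x); rewrite pairingZ mulN1r oppr_ge0.
Qed.

(* [m] is a convex combination of lattice points of the dual polytope; those
   with nonzero weight must also take the minimal value [-1] at all [v i]. *)
Lemma dual_point_integral (R : realType) (n k : nat) (P : set 'rV[R]_n)
    (m : 'cV[R]_n) (v : 'I_k -> 'rV[R]_n) :
  lattice_polytope (dual_polytope P) -> dual_polytope P m ->
  (forall i, P (v i)) -> (forall i, pairing m (v i) = -1) ->
  (forall m', (forall i, pairing m' (v i) = -1) -> m' = m) ->
  lattice_point m.
Proof.
move=> [q [u [ulat dualE]]] Pm Pv mv muniq.
have uP j : dual_polytope P (u j) by rewrite dualE; exact: conv_hull_vertex.
move: Pm; rewrite dualE => -[a [a0 a1 mE]].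
have [j aj] : exists j, a j != 0.
  apply/existsP; rewrite -negb_forall; apply/negP => /forallP a00.
  move: a1; rewrite big1 => [/eqP|i _]; last exact/eqP/a00.
  by rewrite eq_sym oner_eq0.
suff <- : u j = m by exact: ulat.
apply: muniq => i.
have u_ge l : 0 <= a l * (pairing (u l) (v i) + 1).
  by rewrite mulr_ge0 // -lerBlDr sub0r; exact: uP.
have : \sum_l a l * (pairing (u l) (v i) + 1) = 0.
  under eq_bigr do rewrite mulrDr mulr1.
  by rewrite big_split /= a1 -pairing_suml -mE mv addNr.
move=> /eqP; rewrite psumr_eq0 // => /allP /(_ j (mem_index_enum j)) /=.
rewrite mulf_eq0 (negbTE aj) /= addr_eq0 => /eqP ->.
by [].
Qed.

(** * Lattice bases from elementary segments *)

Lemma sum_row_matrix (R : realType) (n k : nat) (v : 'I_k -> 'rV[R]_n)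
    (a : 'rV[R]_k) :
  a *m \matrix_i v i = \sum_i a 0 i *: v i.
Proof. by rewrite mulmx_sum_row; apply: eq_bigr => i _; rewrite rowK. Qed.

(** Pairing a linear relation among the [v i] with [m] gives [c] times the sum of its coefficients,
    so for [c != 0] every linear relation is an affine one. *)
Lemma affinely_independent_row_free (R : realType) (n k : nat)
    (v : 'I_k -> 'rV[R]_n) (m : 'cV[R]_n) (c : R) :
  affinely_independent v -> c != 0 -> (forall i, pairing m (v i) = c) ->
  row_free (\matrix_i v i).
Proof.
move=> vind c0 mv; apply: inj_row_free => a.
rewrite sum_row_matrix => av.
apply/rowP => i; rewrite mxE; apply: (vind (fun i => a 0 i)) => //.
apply: (mulIf c0); rewrite mul0r mulr_suml.
transitivity (pairing m (\sum_j a 0 j *: v j)).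
  by rewrite pairing_sumr; apply: eq_bigr => j _; rewrite mv.
by rewrite av -(scale0r 0) pairingZ mul0r.
Qed.

(* The fractional parts of the coordinates of [w] sum to the integer 0 or 1; in
   the second case they would give a forbidden lattice point of the segment. *)
Lemma elementary_segment_coord_int (R : realType) (v : 'I_2 -> 'rV[R]_2)
    (m : 'cV[R]_2) (w : 'rV[R]_2) (a : 'rV[R]_2) :
  (forall i, lattice_point (v i)) -> row_free (\matrix_i v i) ->
  (forall x, conv_hull v x -> lattice_point x -> exists i, x = v i) ->
  lattice_point m -> (forall i, pairing m (v i) = -1) ->
  lattice_point w -> w = \sum_i a 0 i *: v i ->
  lattice_point a.
Proof.
move=> vlat vfree velem mlat mv wlat wE.
pose f : 'rV[R]_2 := \row_i (a 0 i - (Num.floor (a 0 i))%:~R).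
have f_ge0 i : 0 <= f 0 i by rewrite mxE subr_ge0 ge_floor.
have f_lt1 i : f 0 i < 1 by rewrite mxE ltrBlDl -intrD1 floorD1_gt.
pose x := \sum_i f 0 i *: v i.
have xlat : lattice_point x.
  have -> : x = w - \sum_i (Num.floor (a 0 i))%:~R *: v i.
    rewrite wE -sumrB; apply: eq_bigr => i _.
    by rewrite mxE scalerBl.
  apply/mxOverP => p q; rewrite mxE [X in _ + X]mxE summxE.
  apply: rpredB; first exact/mxOverP.
  apply: rpred_sum => i _; rewrite mxE.
  by have /mxOverP vint := vlat i; apply: rpredM => //; exact: intr_int.
have : pairing m x \is a Num.int by exact: pairing_int.
rewrite pairing_sumr; under eq_bigr do rewrite mv mulrN1.
rewrite sumrN rpredN => fint.
have [f0|f0] := eqVneq (\sum_i f 0 i) 0.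
  apply/mxOverP => i j; rewrite (ord1 i).
  have /eqP : f 0 j = 0.
    move/eqP: f0; rewrite psumr_eq0 // => /allP /(_ j (mem_index_enum j)).
    by move=> /eqP.
  by rewrite mxE subr_eq0 => /eqP ->; exact: intr_int.
have f1 : \sum_i f 0 i = 1.
  have fpos : 0 < \sum_i f 0 i by rewrite lt0r f0 sumr_ge0.
  have flt2 : \sum_i f 0 i < 2.
    rewrite !big_ord_recl big_ord0 addr0.
    by apply: (lt_le_trans (ltrD (f_lt1 _) (f_lt1 _))); lra.
  move: fint fpos flt2 => /intrP [z ->].
  rewrite ltr0z (_ : 2 = 2%:~R) // ltr_int => z0 z2.
  by have -> : z = 1 by lia.
have [|//|i xv] := velem x; first by exists (fun i => f 0 i).
(* The point [x] could still be an endpoint of the segment, but then one of the fractional parts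
   would equal 1. *)
have fE : f = delta_mx 0 i.
  apply: (row_free_inj vfree); rewrite sum_row_matrix -/x xv.
  by rewrite -rowE rowK.
by have := f_lt1 i; rewrite fE mxE !eqxx ltxx.
Qed.

(** * Nonnegative combinations and the quadrant *)

(** The terms with [0 < a i] sum to a vector [(A, B)] with [B <= 0], the others to [(C, E)] with
    [C <= 0]. These two vectors add up to [(1, 1)], so they lie on either side of the quadrant and
    span a cone containing it. *)
Lemma quadrant_comb (R : realType) (k : nat) (l a b : 'I_k -> R) (x y : R) :
  (forall i, 0 <= l i) -> (forall i, a i <= 0 \/ b i <= 0) ->
  \sum_i l i * a i = 1 -> \sum_i l i * b i = 1 -> 0 <= x -> 0 <= y ->
  exists c : 'I_k -> R,
    [/\ forall i, 0 <= c i, \sum_i c i * a i = x & \sum_i c i * b i = y].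
Proof.
move=> l0 ab.
rewrite (bigID (fun i => 0 < a i))
  [X in _ -> X = 1 -> _](bigID (fun i => 0 < a i)) /=.
set A := (X in X + _ = 1 -> _); set C := (X in _ + X = 1 -> _).
set B := (X in _ -> X + _ = 1 -> _); set E := (X in _ -> _ + X = 1 -> _).
have C0 : C <= 0.
  by apply: sumr_le0 => i; rewrite -leNgt => ai; rewrite mulr_ge0_le0.
have B0 : B <= 0.
  apply: sumr_le0 => i ai; rewrite mulr_ge0_le0 //.
  by case: (ab i) => //; rewrite leNgt ai.
move=> AC BE x0 y0.
(* As [A = 1 - C] and [E = 1 - B], this determinant is [1 - B - C >= 1]. Cramer's rule then yields
   the weights [p] and [q] of the two partial sums. *)
pose D := A * E - B * C.
have D0 : 0 < D by rewrite /D; nra.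
pose p := (x * E - y * C) / D; pose q := (y * A - x * B) / D.
have p0 : 0 <= p by rewrite /p divr_ge0 ?(ltW D0) //; nra.
have q0 : 0 <= q by rewrite /q divr_ge0 ?(ltW D0) //; nra.
have sumE (g : 'I_k -> R) :
    \sum_i (l i * if 0 < a i then p else q) * g i =
    p * (\sum_(i | 0 < a i) l i * g i) + q * (\sum_(i | ~~ (0 < a i)) l i * g i).
  rewrite (bigID (fun i => 0 < a i)) /= !mulr_sumr; congr (_ + _).
    by apply: eq_bigr => i ->; rewrite mulrAC mulrC mulrA.
  by apply: eq_bigr => i /negbTE ->; rewrite mulrAC mulrC mulrA.
exists (fun i => l i * if 0 < a i then p else q); split.
- by move=> i; rewrite mulr_ge0 //; case: ifP.
- rewrite sumE -/A -/C /p /q; have := lt0r_neq0 D0; rewrite /D => ?; by field.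
- rewrite sumE -/B -/E /p /q; have := lt0r_neq0 D0; rewrite /D => ?; by field.
Qed.

(* For integers [a + b <= 1] means that [(a, b)] is not in the open quadrant. *)
Lemma int_le1_quadrant (R : realType) (a b : R) :
  a \is a Num.int -> b \is a Num.int -> a + b <= 1 -> a <= 0 \/ b <= 0.
Proof.
move=> /intrP [x ->] /intrP [y ->].
rewrite -intrD (_ : 1 = 1%:~R) // ler_int !lerz0 => xy.
have [x0|y0] : (x <= 0) \/ (y <= 0) by lia.
  by left.
by right.
Qed.

Unset Implicit Arguments.
Set Strict Implicit.

(** * Comparison of the two fans *)

Theorem theorem1p1 (R : realType) (D1 D2 : set 'rV[R]_2)
    (F1 F2 : set (set 'rV[R]_2)) :
  reflexive_polytope D1 -> reflexive_polytope D2 -> D1 `<=` D2 ->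
  MPCP_subdivision D1 F1 -> MPCP_subdivision D2 F2 ->
  refines F2 F1.
Proof.
move=> _ [_ int2 dual2] D12 [[[fan1 complete1] _] _ max1 _]
  [[[fan2 _] _] _ max2 _] s F2s.
have [t2 t2max st2] := fan_cone_subset_maximal fan2 F2s.
have [S2 [G2 [[k [v [vlat vind S2E velem]]] [[m [c [cD2 G2E]]] nG2] SG2 t2E]]] :=
  max2 _ t2max.
have vS i : S2 (v i) by rewrite S2E; exact: conv_hull_vertex.
have vD2 i : D2 (v i) by have := SG2 _ (vS i); rewrite G2E => -[].
have mv i : pairing m (v i) = c by have := SG2 _ (vS i); rewrite G2E => -[].
have c0 : c < 0.
  by apply: (proper_face_level_lt0 int2 cD2); move: nG2; rewrite G2E.
have max1_above x : exists2 t, maximal_cone F1 t & t x.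
  have [t0 F1t0 t0x] := complete1 x.
  have [t tmax t0t] := fan_cone_subset_maximal fan1 F1t0.
  by exists t => //; exact: t0t.
have polyh1 t : maximal_cone F1 t -> rational_polyhedral_cone t.
  by case: fan1 => _ cones1 _ _ [F1t _]; case: (cones1 _ F1t).
(* Cones of [F1] are convex, so it suffices that one of them contains all the generators. *)
suff [t tmax vt] : exists2 t, maximal_cone F1 t & forall i, t (v i).
  exists t; first by case: tmax.
  apply: (subset_trans st2); rewrite t2E => x [r [y [r0]]].
  rewrite S2E => -[a [a0 _ ->]] ->; rewrite scaler_sumr.
  under eq_bigr do rewrite scalerA.
  apply: polyhedral_cone_comb => // [|i]; first exact: polyh1.
  by rewrite mulr_ge0.
(* Independence in the plane leaves one or two generators; for a single ray, completeness of [F1] is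
   enough. *)
have vfree := affinely_independent_row_free vind (ltr0_neq0 c0) mv.
have k2 : (k.+1 <= 2)%N by rewrite -(eqP vfree) rank_leq_col.
case: k v vlat vind S2E velem vS vD2 mv vfree k2 => [|[|//]] v vlat vind S2E
  velem vS vD2 mv vfree _.
  have [t tmax tv] := max1_above (v 0).
  by exists t => // i; rewrite (ord1 i).
pose V : 'M[R]_2 := \matrix_i v i.
have Vunit : V \in unitmx by rewrite -row_free_unit.
(* The positive factor moves the level [c] to [-1], which puts [m'] in the dual polytope of [D2]. *)
pose m' := (- c^-1) *: m.
have m'E x : pairing m' x = - c^-1 * pairing m x.
  by rewrite /pairing -scalemxAr mxE.
have m'v i : pairing m' (v i) = -1.
  by rewrite m'E mv mulNr mulVf // ltr0_neq0.
have m'D2 : dual_polytope D2 m'.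
  move=> x /cD2 cx; rewrite m'E mulNr lerN2 mulrC ler_ndivrMr //.
  by rewrite mul1r.
(* A functional is determined by its values on the basis [v], so [m'] is the only one equal to [-1]
   on it. *)
have m'lat : lattice_point m'.
  apply: (dual_point_integral dual2 m'D2 vD2 m'v) => m1 m1v.
  apply: (can_inj (mulKmx Vunit)); apply/colP => i.
  have VE (z : 'cV[R]_2) : (V *m z) i 0 = pairing z (v i).
    by rewrite /pairing (_ : v i = row i V) -?row_mul ?mxE ?rowK.
  by rewrite !VE m1v m'v.
(* The sum is an interior point of the cone spanned by [v], so every cone containing that cone must
   contain it. *)
have [t tmax tv] := max1_above (\sum_i v i).
exists t => //.
have [S1 [G1 [[p [w [wlat _ S1E _]]] [[m1 [c1 [_ G1E]]] _] SG1 tE]]] :=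
  max1 _ tmax.
have wS i : S1 (w i) by rewrite S1E; exact: conv_hull_vertex.
have wD2 i : D2 (w i) by have := SG1 _ (wS i); rewrite G1E => -[/D12].
have wt i : t (w i).
  by rewrite tE; exists 1, (w i); split => //; rewrite scale1r.
pose a i : 'rV[R]_2 := w i *m invmx V.
have wE i : w i = \sum_j a i 0 j *: v j.
  by rewrite -sum_row_matrix mulmxKV.
have alat i : lattice_point (a i).
  apply: (elementary_segment_coord_int vlat vfree _ m'lat m'v (wlat i) (wE i)).
  by rewrite -S2E.
have a_quadrant i : a i 0 0 <= 0 \/ a i 0 1 <= 0.
  have /mxOverP aint := alat i; apply: int_le1_quadrant => //.
  (* Since [m'] is [-1] on both basis vectors, its bound [-1] at [w i] says that the coordinates of
     [w i] sum to at most 1. *)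
  have := m'D2 _ (wD2 i); rewrite {1}wE pairing_sumr.
  rewrite !big_ord_recl big_ord0 !m'v.
  rewrite (_ : lift _ _ = 1) //; last exact/val_inj.
  by lra.
move: tv; rewrite {1}tE => -[r [y [r0]]].
rewrite S1E => -[b [b0 _ ->]] vE.
have comb_coord (l : 'I_p.+1 -> R) j :
    ((\sum_i l i *: w i) *m invmx V) 0 j = \sum_i l i * a i 0 j.
  rewrite mulmx_suml summxE; apply: eq_bigr => i _.
  by rewrite -scalemxAl mxE.
have rb_coord j : \sum_i r * b i * a i 0 j = 1.
  rewrite -comb_coord; under eq_bigr do rewrite -scalerA.
  rewrite -scaler_sumr -vE.
  have -> : \sum_i v i = const_mx 1 *m V.
    by rewrite sum_row_matrix; apply: eq_bigr => i _; rewrite mxE scale1r.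
  by rewrite mulmxK // mxE.
move=> j.
(* The target point is the unit vector of coordinates of [v j], on the boundary of the quadrant. *)
have [i|||l [l0 la0 la1]] := @quadrant_comb R _ (fun i => r * b i)
  (fun i => a i 0 0) (fun i => a i 0 1) (j == 0)%:R (j == 1)%:R _ a_quadrant
  (rb_coord 0) (rb_coord 1).
- by rewrite mulr_ge0.
- exact: ler0n.
- exact: ler0n.
have -> : v j = \sum_i l i *: w i.
  rewrite -[v j](rowK v) rowE -[RHS](mulmxKV Vunit); congr (_ *m _).
  apply/rowP => i; rewrite comb_coord mxE eqxx.
  have [->|->] : i = 0 \/ i = 1.
    by case: i => -[|[|//]] ?; [left | right]; exact/val_inj.
  - by rewrite la0 eq_sym.
  - by rewrite la1 eq_sym.
by apply: polyhedral_cone_comb => //; exact: polyh1.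
Qed.
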